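(* Let $a_1,a_2\in\mathbb{R}$, let $x_0\in(a,b)\cap F$, and let $f_0, f_0'\in\mathbb{R}$ be given constants. Consider the second $\alpha$-order fractal differential equation $$D_x^{2\alpha}f(x)+a_1D_x^{\alpha}f(x)+a_2f(x)=0,\qquad x\in(a,b)\cap F, \qquad (\ast)$$ with the initial conditions $f(x_0)=f_0$ and $D_x^{\alpha}f(x)|_{x=x_0}=f_0'$. Let $\psi_1,\psi_2$ be the following two linearly independent solutions of $(\ast)$, determined by the characteristic equation $r^2+a_1r+a_2=0$: (i) if $a_1^2-4a_2>0$, with distinct real roots $r_1,r_2$: $\psi_1(x)=\exp(r_1S_F^\alpha(x))$, $\psi_2(x)=\exp(r_2S_F^\alpha(x))$; (ii) if $a_1^2-4a_2<0$, with roots $\lambda\pm i\nu$ ($\lambda,\nu\in\mathbb{R}$, $\nu\neq 0$): $\psi_1(x)=\exp(\lambda S_F^\alpha(x))\cos(\nu S_F^\alpha(x))$, $\psi_2(x)=\exp(\lambda S_F^\alpha(x))\sin(\nu S_F^\alpha(x))$; (iii) if $a_1^2-4a_2=0$: $\psi_1(x)=\exp(-a_1S_F^\alpha(x)/2)$, $\psi_2(x)=S_F^\alpha(x)\exp(-a_1S_F^\alpha(x)/2)$. Then there exist two constants $c_1,c_2\in\mathbb{R}$ such that $\psi(x)=c_1\psi_1(x)+c_2\psi_2(x)$ is a solution of $(\ast)$ satisfying $\psi(x_0)=f_0$ and $D_x^\alpha\psi(x)|_{x=x_0}=f_0'$.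
   Context: Let $0<\alpha\le 1$, $F\subset\mathbb{R}$, and $(a,b)$ an open interval. For an interval $I$ put $\rho(F,I)=1$ if $F\cap I\ne\emptyset$ and $0$ otherwise. For $u<v$ and $\delta>0$ let $\gamma^\alpha_\delta(F,u,v)=\inf\sum_{i=0}^{n-1}\Gamma(\alpha+1)(t_{i+1}-t_i)^\alpha\rho(F,[t_i,t_{i+1}])$, the infimum over subdivisions $u=t_0<\dots<t_n=v$ with $\max_i(t_{i+1}-t_i)\le\delta$; $\gamma^\alpha(F,u,v)=\lim_{\delta\to0}\gamma^\alpha_\delta(F,u,v)$ (and $\gamma^\alpha(F,u,u)=0$). Fix $a_0\in\mathbb{R}$. The integral staircase function is $S_F^\alpha(x)=\gamma^\alpha(F,a_0,x)$ if $x\ge a_0$ and $S_F^\alpha(x)=-\gamma^\alpha(F,x,a_0)$ otherwise. $F$ is $\alpha$-perfect: $S_F^\alpha$ is finite on $\mathbb{R}$, $F$ is closed with no isolated points, and $F$ is exactly the set of points $x$ such that $S_F^\alpha$ is not constant on any open interval containing $x$. For $x\in F$, $\mathrm{F\text{-}lim}_{y\to x}h(y)=\ell$ means: for every $\varepsilon>0$ there is $\delta>0$ with $|h(y)-\ell|<\varepsilon$ for all $y\in F$ with $0<|y-x|<\delta$. The $F^\alpha$-derivative of $f:(a,b)\to\mathbb{R}$ is $D_x^\alpha f(x)=\mathrm{F\text{-}lim}_{y\to x}\frac{f(y)-f(x)}{S_F^\alpha(y)-S_F^\alpha(x)}$ if $x\in F$ (when the limit exists), and $0$ if $x\notin F$;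 $D_x^{2\alpha}f=D_x^\alpha(D_x^\alpha f)$. $C^{n,\alpha}(a,b)$ is the set of $f:(a,b)\to\mathbb{R}$ that are $n$ times $F^\alpha$-differentiable at every point of $F\cap(a,b)$. A solution of a second $\alpha$-order equation is a function in $C^{2,\alpha}(a,b)$ satisfying the equation at all points of $F\cap(a,b)$. *)

(* Defs.v *)
From HB Require Import structures.
From mathcomp Require Import all_boot all_order all_algebra.
From mathcomp Require Import all_classical all_reals all_analysis.
From mathcomp Require Import complex.

Set Implicit Arguments.
Unset Strict Implicit.
Unset Printing Implicit Defensive.

Import Order.TTheory GRing.Theory Num.Theory.
Import numFieldNormedType.Exports.

Local Open Scope classical_set_scope.
Local Open Scope ring_scope.

Section staircase.
Context {R : realType}.

(* Euler's integral: the Gamma function for 0 < s. *)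
Definition Gamma (s : R) : R :=
  \int[lebesgue_measure]_(t in `]0, +oo[) (t `^ (s - 1) * expR (- t)).

Definition rho (F I : set R) : R := (F `&` I != set0)%:R.

(* A subdivision u = t_0 < ... < t_n = v is given by the sequence
   s = [:: t_1; ...; t_n]; its points are the entries of u :: s. *)
Definition subdivision (u v delta : R) (s : seq R) : Prop :=
  itv_partition u v s /\
  forall i, (i < size s)%N ->
    nth v (u :: s) i.+1 - nth v (u :: s) i <= delta.

Definition coarse_sum (F : set R) (alpha u v : R) (s : seq R) : R :=
  let t := nth v (u :: s) in
  \sum_(i < size s)
     Gamma (alpha + 1) * (t i.+1 - t i) `^ alpha * rho F `[t i, t i.+1].

Definition coarse_mass_delta (F : set R) (alpha delta u v : R) : \bar R :=
  ereal_inf [set (coarse_sum F alpha u v s)%:E | s in subdivision u v delta].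

(* The limit always exists, possibly equal to +oo: the infimum can only
   increase when delta decreases. *)
Definition coarse_mass (F : set R) (alpha u v : R) : \bar R :=
  if u < v then
    lim (coarse_mass_delta F alpha delta u v @[delta --> 0^'+])
  else 0%E.

Definition staircase_ereal (F : set R) (alpha a0 x : R) : \bar R :=
  if a0 <= x then coarse_mass F alpha a0 x
  else (- coarse_mass F alpha x a0)%E.

(* Meaningful when staircase_ereal is finite everywhere, which is part of
   alpha_perfect. *)
Definition staircase (F : set R) (alpha a0 x : R) : R :=
  fine (staircase_ereal F alpha a0 x).

Definition constant_on (g : R -> R) (I : set R) : Prop :=
  forall y z, I y -> I z -> g y = g z.

Definition alpha_perfect (F : set R) (alpha a0 : R) : Prop :=
  [/\ forall x, staircase_ereal F alpha a0 x \is a fin_num,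
      closed F,
      isolated F = set0 &
      F = [set x | forall u v, u < x < v ->
                     ~ constant_on (staircase F alpha a0) `]u, v[]].

End staircase.

Section falpha_derivative.
Context {R : realType}.
Variables (F : set R) (alpha a0 : R).
Local Notation S := (staircase F alpha a0).

(* For F alpha-perfect and x in F, S y != S x for all y in F close enough to
   x with y != x, so that the convention z / 0 = 0 plays no role in limits of
   this quotient along F. *)
Definition Fquotient (f : R -> R) (x y : R) : R := (f y - f x) / (S y - S x).

(* within F x^' is the filter of the punctured neighborhoods of x in F: a
   limit along it is an F-limit. It is a proper filter when x is in F and F has
   no isolated points, so that lim below is then the unique F-limit. *)
Definition Fderivable (f : R -> R) (x : R) : Prop :=
  F x -> cvg (Fquotient f x y @[y --> within F x^']).

Definition Fderive (f : R -> R) (x : R) : R :=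
  if x \in F then lim (Fquotient f x y @[y --> within F x^']) else 0.

(* Functions on ]a, b[ are represented by functions on R: as ]a, b[ is open,
   the successive derivatives at a point of ]a, b[ only depend on the values
   on ]a, b[. *)
Definition Fcontdiff (n : nat) (a b : R) (f : R -> R) : Prop :=
  forall k x, (k < n)%N -> x \in `]a, b[ -> x \in F ->
    Fderivable (iter k Fderive f) x.

Definition is_solution (a b a1 a2 : R) (f : R -> R) : Prop :=
  Fcontdiff 2 a b f /\
  forall x, x \in `]a, b[ -> x \in F ->
    Fderive (Fderive f) x + a1 * Fderive f x + a2 * f x = 0.

End falpha_derivative.

Section characteristic_equation.
Context {R : realType}.

Definition characteristic (a1 a2 : R) : {poly R} :=
  'X^2 + a1 *: 'X + a2%:P.

(* The pair (psi1, psi2) attached to the characteristic equation, for a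
   staircase function S. *)
Inductive fundamental_pair (S : R -> R) (a1 a2 : R) :
    (R -> R) -> (R -> R) -> Prop :=
| Distinct_real_roots (r1 r2 : R) :
    a1 ^+ 2 - 4 * a2 > 0 -> r1 != r2 ->
    root (characteristic a1 a2) r1 -> root (characteristic a1 a2) r2 ->
    fundamental_pair S a1 a2
      (fun x => expR (r1 * S x)) (fun x => expR (r2 * S x))
| Complex_roots (lambda nu : R) :
    a1 ^+ 2 - 4 * a2 < 0 -> nu != 0 ->
    root (map_poly (real_complex R) (characteristic a1 a2))
         (Complex lambda nu) ->
    root (map_poly (real_complex R) (characteristic a1 a2))
         (Complex lambda (- nu)) ->
    fundamental_pair S a1 a2
      (fun x => expR (lambda * S x) * cos (nu * S x))
      (fun x => expR (lambda * S x) * sin (nu * S x))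
| Double_root :
    a1 ^+ 2 - 4 * a2 = 0 ->
    fundamental_pair S a1 a2
      (fun x => expR (- a1 * S x / 2)) (fun x => S x * expR (- a1 * S x / 2)).

End characteristic_equation.

(* Main.v *)
Require Import Defs.
From mathcomp Require Import all_boot all_order all_algebra.
From mathcomp Require Import all_classical all_reals all_analysis.
From mathcomp Require Import complex ring lra.

Set Implicit Arguments.
Unset Strict Implicit.
Unset Printing Implicit Defensive.

Import Order.TTheory GRing.Theory Num.Theory.
Import numFieldNormedType.Exports.

Local Open Scope classical_set_scope.
Local Open Scope ring_scope.

(* An inserted point raises a coarse sum of mesh at most d by at most
   Gamma(alpha + 1) d^alpha, so the mass is additive, and the difference of two
   values of the staircase S is the mass of the interval in between. Hence S is
   nondecreasing, and it has no jump: cutting off a piece of length d costs only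
   Gamma(alpha + 1) d^alpha.
   At a point x of F, S y != S x for y in F close to x, so by Caratheodory's
   form of differentiability the F-derivative of g \o S at x is g'(S x). The
   fractal equation for g \o S on F thus follows from the classical equation
   for g, and c1, c2 are given by Cramer's rule, as the Wronskian is nonzero. *)

(** * Coarse sums over subdivisions *)

Section coarse_mass_theory.
Context {R : realType} (F : set R) (alpha : R).
Hypothesis alpha_gt0 : 0 < alpha.
Implicit Types (u v w x d : R) (s : seq R).

Local Notation K := (Gamma (alpha + 1)).
Local Notation mass_delta := (coarse_mass_delta F alpha).
Local Notation mass := (coarse_mass F alpha).

Lemma Gamma_ge0 (z : R) : 0 <= Gamma z.
Proof.
apply: Rintegral_ge0 => t _; by rewrite mulr_ge0 ?powR_ge0 ?expR_ge0.
Qed.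

Definition cell u v : R := K * (v - u) `^ alpha * rho F `[u, v].

(** Structural recursion replaces the indexed sum of [coarse_sum], so that cutting and concatenating
    subdivisions become list inductions. *)
Fixpoint chain_sum u s : R :=
  if s is v :: s' then cell u v + chain_sum v s' else 0.

(** Strict increase and the mesh bound in a single relation: a subdivision is then a [path], and the
    lemmas on [path] apply. *)
Definition fine_step d : rel R := fun x y => (x < y) && (y - x <= d).

Lemma coarse_sumE u v s : coarse_sum F alpha u v s = chain_sum u s.
Proof.
rewrite /coarse_sum; elim: s u => [|x s IH] u /=; first by rewrite big_ord0.
by rewrite big_ord_recl -IH.
Qed.

Lemma subdivisionE u v d s :
  subdivision u v d s <-> path (fine_step d) u s /\ last u s = v.
Proof.
rewrite /subdivision /itv_partition; split.
  move=> [[/(pathP v) us /eqP sv] sd]; split=> //; apply/(pathP v) => i ilt.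
  by rewrite /fine_step us //=; exact: sd.
move=> [us sv]; split; first split; last 2 first.
- exact/eqP.
- by move=> i ilt; have /andP[] := (pathP v us) i ilt.
by apply: sub_path us => x y /andP[].
Qed.

Lemma cell_ge0 u v : 0 <= cell u v.
Proof. by rewrite !mulr_ge0 ?Gamma_ge0 ?powR_ge0 ?ler0n. Qed.

Lemma chain_sum_ge0 u s : 0 <= chain_sum u s.
Proof. by elim: s u => //= v s IH u; rewrite addr_ge0 ?cell_ge0. Qed.

Lemma chain_sum_cat u s t :
  chain_sum u (s ++ t) = chain_sum u s + chain_sum (last u s) t.
Proof. by elim: s u => [|v s IH] u /=; rewrite ?add0r // IH addrA. Qed.

Lemma rho_le1 (I : set R) : rho F I <= 1.
Proof. by rewrite /rho; case: (_ != _). Qed.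

Lemma le_rho (I J : set R) : I `<=` J -> rho F I <= rho F J.
Proof.
move=> IJ; rewrite /rho; have [_|/set0P[z [Fz Iz]]] := eqVneq (F `&` I) set0.
  exact: ler0n.
suff -> : F `&` J != set0 by [].
by apply/set0P; exists z; split; [|exact: IJ].
Qed.

Lemma cell_le_powR u v d : u <= v -> v - u <= d -> cell u v <= K * d `^ alpha.
Proof.
move=> uv vud; have d0 : 0 <= d by rewrite (le_trans _ vud)// subr_ge0.
rewrite /cell -[leRHS]mulr1 ler_pM//;
  rewrite ?mulr_ge0 ?Gamma_ge0 ?powR_ge0 ?ler0n ?rho_le1//.
rewrite ler_wpM2l ?Gamma_ge0//.
by rewrite ge0_ler_powR ?nnegrE ?subr_ge0 ?(ltW alpha_gt0).
Qed.

Lemma le_cell u v w : u <= v -> v <= w -> cell v w <= cell u w.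
Proof.
move=> uv vw; rewrite /cell ler_pM ?mulr_ge0 ?Gamma_ge0 ?powR_ge0 ?ler0n//.
  rewrite ler_wpM2l ?Gamma_ge0// ge0_ler_powR//;
    rewrite ?nnegrE ?subr_ge0 ?(ltW alpha_gt0)//.
  - exact: le_trans uv vw.
  - by rewrite lerD2l lerN2.
apply: le_rho => z /=; rewrite !in_itv/= => /andP[vz ->].
by rewrite (le_trans uv).
Qed.

(** Only the cell containing [v] changes. Its right piece costs no more than the whole cell, by
    [le_cell], and its left piece, of length at most [d], accounts for the error. If [v] is already
    a subdivision point, nothing is added. *)
Lemma chain_sum_split u v w d s : 0 <= d -> u < v < w ->
  path (fine_step d) u s -> last u s = w ->
  exists s1 s2, [/\ path (fine_step d) u s1, last u s1 = v,
    path (fine_step d) v s2, last v s2 = w &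
    chain_sum u s1 + chain_sum v s2 <= chain_sum u s + K * d `^ alpha].
Proof.
move=> d0; have Kd : 0 <= K * d `^ alpha.
  by rewrite mulr_ge0 ?Gamma_ge0 ?powR_ge0.
elim: s u => [|x s IH] u /= /andP[uv vw].
  by move=> _ uw; move: (lt_trans uv vw); rewrite uw ltxx.
move=> /andP[/andP[ux xud] xs] sw; have [xv|vx|xv] := ltgtP x v.
- have [|//|//|s1 [s2 [h1 h2 h3 h4 h5]]] := IH x; first by rewrite xv.
  exists (x :: s1), s2; split => //=; first by rewrite /fine_step ux xud.
  by rewrite -!addrA lerD2l.
- exists [:: v], (x :: s); split => //=.
  + by rewrite /fine_step uv/= andbT (le_trans _ xud)// lerD2r ltW.
  + by rewrite /fine_step vx xs/= andbT (le_trans _ xud)// lerD2l lerN2 ltW.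
  + have := @le_cell u v x (ltW uv) (ltW vx).
    have : cell u v <= K * d `^ alpha.
      by apply: cell_le_powR (ltW uv) _; rewrite (le_trans _ xud)// lerD2r ltW.
    lra.
- subst x; exists [:: v], s; split => //=; first by rewrite /fine_step ux xud.
  by rewrite addr0 lerDl.
Qed.

(** * Masses at scale [d], and additivity of their limit *)

Lemma mass_delta_ge0 d u v : (0 <= mass_delta d u v)%E.
Proof.
apply: le_ereal_inf_tmp => _ [s _ <-].
by rewrite lee_fin coarse_sumE chain_sum_ge0.
Qed.

Lemma le_mass_delta d d' u v : d <= d' ->
  (mass_delta d' u v <= mass_delta d u v)%E.
Proof.
move=> dd'; apply: ereal_inf_le_tmp => _ [s [us sd] <-].
by exists s => //; split=> // i /sd /le_trans; apply.
Qed.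

(** Concatenating subdivisions of the two intervals gives one of the union, with the same mesh
    bound. *)
Lemma mass_delta_subadd d u v w :
  (mass_delta d u w <= mass_delta d u v + mass_delta d v w)%E.
Proof.
(* A term must be finite to be moved across the inequality; if this one is infinite, so is the
   right-hand side. *)
have [->|vwoo] := eqVneq (mass_delta d v w) +oo%E.
  by rewrite addey ?leey// gt_eqF// (lt_le_trans _ (mass_delta_ge0 _ _ _)).
have vwfin : mass_delta d v w \is a fin_num.
  by rewrite ge0_fin_numE ?mass_delta_ge0// ltey.
rewrite -leeBlDr//; apply: le_ereal_inf_tmp => _ [s1 /subdivisionE[us1 s1v] <-].
rewrite leeBlDr// addeC -leeBlDr//.
apply: le_ereal_inf_tmp => _ [s2 /subdivisionE[vs2 s2w] <-].
rewrite leeBlDr// addeC -EFinD !coarse_sumE.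
apply: ereal_inf_lbound; exists (s1 ++ s2).
  by apply/subdivisionE; rewrite cat_path last_cat s1v us1 vs2.
by rewrite coarse_sumE chain_sum_cat s1v.
Qed.

Lemma mass_delta_superadd d u v w : 0 <= d -> u < v < w ->
  (mass_delta d u v + mass_delta d v w <=
   mass_delta d u w + (K * d `^ alpha)%:E)%E.
Proof.
move=> d0 uvw; rewrite -leeBlDr//; apply: le_ereal_inf_tmp => _ [s us <-].
have /subdivisionE[us' sw] := us.
have [s1 [s2 [h1 h2 h3 h4 h5]]] := chain_sum_split d0 uvw us' sw.
rewrite leeBlDr// (@le_trans _ _ (chain_sum u s1 + chain_sum v s2)%:E)//.
  rewrite EFinD leeD//; apply: ereal_inf_lbound.
    by exists s1; [exact/subdivisionE|rewrite coarse_sumE].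
  by exists s2; [exact/subdivisionE|rewrite coarse_sumE].
by rewrite -EFinD lee_fin coarse_sumE.
Qed.

(** A monotone function of [d] has a one-sided limit in the extended reals, so the [lim] in
    [coarse_mass] is a genuine limit. *)
Lemma mass_delta_cvg u v : u < v ->
  mass_delta d u v @[d --> 0^'+] --> mass u v.
Proof.
move=> uv; rewrite /coarse_mass uv.
apply: nonincreasing_at_right_is_cvge; near=> x => y z _ _.
exact: le_mass_delta.
Unshelve. all: end_near. Qed.

Lemma mass_ge0 u v : (0 <= mass u v)%E.
Proof.
have [uv|vu] := ltP u v; last by rewrite /coarse_mass ltNge vu.
apply: cvge_to_ge (mass_delta_cvg uv) _.
by near=> d; exact: mass_delta_ge0.
Unshelve. all: end_near. Qed.

Lemma cell_bound_cvg : (K * d `^ alpha)%:E @[d --> 0^'+] --> 0%:E.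
Proof.
apply: cvg_EFin; first by near=> d.
rewrite -[X in _ --> X](mulr0 K); apply: cvgM.
  exact: cvg_cst.
exact: powR_cvg0.
Unshelve. all: end_near. Qed.

Lemma massD u v w : u <= v -> v <= w -> (mass u v + mass v w)%E = mass u w.
Proof.
(* The degenerate cases rest on the [else] branch of [coarse_mass]. *)
have mass_id x : mass x x = 0%E by rewrite /coarse_mass ltxx.
rewrite le_eqVlt => /orP[/eqP <- _|uv]; first by rewrite mass_id add0e.
rewrite le_eqVlt => /orP[/eqP <-|vw]; first by rewrite mass_id adde0.
have cuvw : (mass_delta d u v + mass_delta d v w)%E @[d --> 0^'+] -->
    (mass u v + mass v w)%E.
  by apply: cvgeD (mass_delta_cvg uv) (mass_delta_cvg vw);
    rewrite ge0_adde_def ?inE ?mass_ge0.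
have cuw := mass_delta_cvg (lt_trans uv vw).
apply/eqP; rewrite eq_le; apply/andP; split.
  rewrite -[leRHS]adde0; apply: lee_cvg_to cuvw _ _.
    apply: cvgeD cuw cell_bound_cvg. by rewrite ge0_adde_def ?inE ?mass_ge0.
  near=> d; apply: mass_delta_superadd => //; by rewrite uv.
apply: lee_cvg_to cuw cuvw _; near=> d; exact: mass_delta_subadd.
Unshelve. all: end_near. Qed.

(** Refining the mesh only raises the infimum, so every scale bounds the limit from below. *)
Lemma mass_delta_le_mass d u v : 0 < d -> u < v ->
  (mass_delta d u v <= mass u v)%E.
Proof.
move=> d0 uv; apply: cvge_to_ge (mass_delta_cvg uv) _.
near=> e; apply: le_mass_delta; near: e; exact: nbhs_right_le.
Unshelve. all: end_near. Qed.

Lemma mass_delta_le_powR d u v : u < v -> v - u <= d ->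
  (mass_delta d u v <= (K * d `^ alpha)%:E)%E.
Proof.
move=> uv vud; apply: (@le_trans _ _ (chain_sum u [:: v])%:E).
  apply: ereal_inf_lbound; exists [:: v]; last by rewrite coarse_sumE.
  by apply/subdivisionE; rewrite /= /fine_step uv vud.
by rewrite lee_fin /= addr0 cell_le_powR// ltW.
Qed.

Lemma mass_delta_near u v (e : R) : 0 < e -> u < v -> mass u v \is a fin_num ->
  \forall d \near 0^'+, (mass u v < mass_delta d u v + e%:E)%E.
Proof.
move=> e0 uv uvfin; have := mass_delta_cvg uv; rewrite -(fineK uvfin).
move=> /fine_cvgP[dfin dcvg].
have lte : fine (mass u v) - e < fine (mass u v) by rewrite ltrBlDr ltrDl.
near=> d.
have dfin' : mass_delta d u v \is a fin_num by near: d.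
rewrite -(fineK dfin') -EFinD lte_fin -ltrBlDr.
by near: d; exact: cvgr_gt dcvg _ lte.
Unshelve. all: end_near. Qed.

Lemma cell_bound_near (e : R) : 0 < e ->
  \forall d \near 0^'+, K * d `^ alpha < e.
Proof.
by move=> e0; have /fine_cvgP[_] := cell_bound_cvg; move=> /cvgr_lt; exact.
Qed.

(** * Monotonicity and continuity of the staircase *)

Section staircase_theory.
Variable a0 : R.
Hypothesis Sfin : forall x, staircase_ereal F alpha a0 x \is a fin_num.
Local Notation S := (staircase F alpha a0).

Lemma staircaseE x : (S x)%:E = staircase_ereal F alpha a0 x.
Proof. exact: fineK. Qed.

(** Additivity of the mass, in three cases: [a0] left of both points, between them, or right of
    both. Finiteness of the staircase allows the common mass to cancel when [a0] is not between
    them. *)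
Lemma staircaseB x y : x <= y -> (S y - S x)%:E = mass x y.
Proof.
move=> xy; rewrite EFinB !staircaseE.
have := Sfin x; have := Sfin y; rewrite /staircase_ereal.
have [a0x|xa0] := leP a0 x.
  rewrite (le_trans a0x xy) -(massD a0x xy) => yfin xfin.
  by rewrite addeAC subee// add0e.
have [a0y|ya0] := leP a0 y.
  by rewrite oppeK addeC -(massD (ltW xa0) a0y).
rewrite oppeK -(massD xy (ltW ya0)) fin_numN => yfin _.
by rewrite addeC -addeA subee// adde0.
Qed.

Lemma staircase_homo : {homo S : x y / x <= y}.
Proof.
by move=> x y xy; rewrite -subr_ge0 -lee_fin staircaseB// mass_ge0.
Qed.

(** Take [d] so small that the mass of the unit interval ending at [b] is within [e / 2] of its
    value at scale [d], and cut at [b - d]. The long piece costs at most its own mass and the short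
    one less than [e / 2]; subtracting the mass of the long piece leaves less than [e] for the short
    one. *)
Lemma staircase_left (e b : R) : 0 < e -> exists2 u, u < b & S b - S u < e.
Proof.
move=> e0; have e20 : 0 < e / 2 by rewrite divr_gt0.
have bb : b - 1 < b by rewrite ltrBlDr ltrDl.
have bfin : mass (b - 1) b \is a fin_num by rewrite -staircaseB ?ltW.
near (0 : R)^'+ => d.
have d0 : 0 < d by near: d; exact: nbhs_right_gt.
have d1 : d < 1 by near: d; exact: nbhs_right_lt.
have Kd : K * d `^ alpha < e / 2 by near: d; exact: cell_bound_near.
have bd : (mass (b - 1) b < mass_delta d (b - 1) b + (e / 2)%:E)%E.
  by near: d; exact: mass_delta_near.
have ub : b - d < b by rewrite ltrBlDr ltrDl.
have bu : b - 1 < b - d by rewrite ltrD2l ltrN2.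
exists (b - d) => //.
have := lt_le_trans bd (leeD2r _ (mass_delta_subadd d (b - 1) (b - d) b)).
have h1 := mass_delta_le_mass d0 bu.
have h2 : (mass_delta d (b - d) b <= (K * d `^ alpha)%:E)%E.
  by apply: mass_delta_le_powR => //; rewrite opprB addrC subrK.
move=> /lt_le_trans /(_ (leeD2r _ (leeD h1 h2))).
by rewrite -!staircaseB ?ltW// -!EFinD lte_fin;
  move: (S _) (S _) (S _) (K * _) Kd => *; lra.
Unshelve. all: end_near. Qed.

(** Mirror image of [staircase_left], with the cut at [b + d]. *)
Lemma staircase_right (e b : R) : 0 < e -> exists2 v, b < v & S v - S b < e.
Proof.
move=> e0; have e20 : 0 < e / 2 by rewrite divr_gt0.
have bb : b < b + 1 by rewrite ltrDl.
have bfin : mass b (b + 1) \is a fin_num by rewrite -staircaseB ?ltW.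
near (0 : R)^'+ => d.
have d0 : 0 < d by near: d; exact: nbhs_right_gt.
have d1 : d < 1 by near: d; exact: nbhs_right_lt.
have Kd : K * d `^ alpha < e / 2 by near: d; exact: cell_bound_near.
have bd : (mass b (b + 1) < mass_delta d b (b + 1) + (e / 2)%:E)%E.
  by near: d; exact: mass_delta_near.
have bv : b < b + d by rewrite ltrDl.
have vb : b + d < b + 1 by rewrite ltrD2l.
exists (b + d) => //.
have := lt_le_trans bd (leeD2r _ (mass_delta_subadd d b (b + d) (b + 1))).
have h1 := mass_delta_le_mass d0 vb.
have h2 : (mass_delta d b (b + d) <= (K * d `^ alpha)%:E)%E.
  by apply: mass_delta_le_powR => //; rewrite addrC addKr.
move=> /lt_le_trans /(_ (leeD2r _ (leeD h2 h1))).
by rewrite -!staircaseB ?ltW// -!EFinD lte_fin;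
  move: (S _) (S _) (S _) (K * _) Kd => *; lra.
Unshelve. all: end_near. Qed.

Lemma staircase_continuous : continuous S.
Proof.
move=> b; apply/cvgrPdist_lt => e e0.
have [u ub ue] := staircase_left b e0.
have [v bv ve] := staircase_right b e0.
near=> y.
have uy : u < y by near: y; exact: lt_nbhsr.
have yv : y < v by near: y; exact: lt_nbhsl.
have := staircase_homo (ltW uy); have := staircase_homo (ltW yv).
by rewrite ltr_norml; move: (S _) (S _) (S _) (S _) ue ve => *; lra.
Unshelve. all: end_near. Qed.

End staircase_theory.
End coarse_mass_theory.

(** * Chain rule along the set of change of a continuous monotone function *)

Section chain_rule.
Context {R : realType} (F : set R) (S : R -> R).
Hypothesis Fchange : F = [set x | forall u v, u < x < v ->
  ~ constant_on S `]u, v[].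

Hypothesis S_homo : {homo S : x y / x <= y}.
Hypothesis S_continuous : continuous S.

(** By monotonicity, equal values at the ends force [S] to be constant in between. *)
Lemma flat_notin u x v : u < x < v -> S u = S v -> ~ F x.
Proof.
move=> uxv Suv; rewrite Fchange => /(_ u v uxv); apply.
have Sy y : `]u, v[%classic y -> S y = S u.
  rewrite /= in_itv/= => /andP[/ltW uy /ltW yv].
  have := S_homo uy; have := S_homo yv; rewrite -Suv => h1 h2.
  by apply: le_anti; rewrite h1 h2.
by move=> y z /Sy -> /Sy ->.
Qed.

(* If S z = S x with z != x, then F has no point strictly between x and z. *)
Lemma S_neq_near x : \forall y \near within F x^', S y != S x.
Proof.
have right_side : \forall y \near x, F y -> x < y -> S y != S x.
  have [[z [xz Szx]]|noz] := pselect (exists z, x < z /\ S z = S x).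
    near=> y => Fy xy; exfalso; apply: (@flat_notin x y z) => //.
    by rewrite xy/=; near: y; exact: lt_nbhsl.
  by near=> y => _ xy; apply/eqP => Syx; apply: noz; exists y.
have left_side : \forall y \near x, F y -> y < x -> S y != S x.
  have [[z [zx Szx]]|noz] := pselect (exists z, z < x /\ S z = S x).
    near=> y => Fy yx; exfalso; apply: (@flat_notin z y x) => //.
    by rewrite yx andbT; near: y; exact: lt_nbhsr.
  by near=> y => _ yx; apply/eqP => Syx; apply: noz; exists y.
suff : \forall y \near x, y != x -> F y -> S y != S x by [].
near=> y; rewrite neq_lt => /orP[yx|xy] Fy.
  by move: Fy yx; near: y.
by move: Fy xy; near: y.
Unshelve. all: end_near. Qed.

(** Near [x] in [F] the quotient equals [h (S y)], where [h] is the Caratheodory slope of [g] at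
    [S x], continuous there with value [l]. Agreement of [f] and [g \o S] is asked on [F] only, so
    that the lemma also applies to F-derivatives, which are 0 off [F]. *)
Lemma quotient_cvg (f g : R -> R) (l x : R) : F x ->
  (forall y, F y -> f y = g (S y)) -> is_derive (S x) 1 g l ->
  (f y - f x) / (S y - S x) @[y --> within F x^'] --> l.
Proof.
move=> Fx fg /is_derive1_caratheodory[h [gh hcont <-]].
have hS : h (S y) @[y --> within F x^'] --> h (S x).
  have hSx : h (S y) @[y --> x] --> h (S x).
    exact: continuous_comp (@S_continuous x) hcont.
  (* The filter [x^'] is itself a [within] filter, so restriction is applied twice. *)
  apply: cvg_trans hSx; apply: cvg_app => V Vx.
  by apply: cvg_within; exact: cvg_within.
apply: cvg_trans hS; apply: near_eq_cvg.
apply: filterS2 (withinT F _) (S_neq_near x) => y Fy Sy.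
by rewrite !fg// gh mulfK// subr_eq0.
Qed.

End chain_rule.

(** If the filter contained the empty set, some neighborhood of [x] would meet [F] in [x] alone.
    Properness makes F-limits unique, hence computable through [lim]. *)
Lemma within_dnbhs_proper {R : realType} (F : set R) (x : R) :
  isolated F = set0 -> F x -> ProperFilter (within F x^').
Proof.
move=> isoF Fx; apply: Build_ProperFilter => F0.
suff : isolated F x by rewrite isoF.
split; first exact: mem_set.
exists [set y | y != x -> ~ F y] => //.
apply/seteqP; split=> [y [+ Fy]|_ ->] /=.
  by have [//|yx /(_ yx)] := eqVneq y x.
by split=> //; rewrite eqxx.
Qed.

(** * F-derivatives of functions of the staircase *)

Section alpha_perfect_derivative.
Context {R : realType} (F : set R) (alpha a0 : R).
Hypothesis alpha_gt0 : 0 < alpha.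
Hypothesis perfectF : alpha_perfect F alpha a0.
Local Notation S := (staircase F alpha a0).

Lemma Fquotient_cvg (f g : R -> R) (l x : R) : F x ->
  (forall y, F y -> f y = g (S y)) -> is_derive (S x) 1 g l ->
  Fquotient F alpha a0 f x y @[y --> within F x^'] --> l.
Proof.
have [Sfin _ _ Fchange] := perfectF.
apply: (@quotient_cvg _ _ S Fchange).
- exact: staircase_homo.
- exact: staircase_continuous.
Qed.

Lemma Fderivable_comp (f g : R -> R) (l x : R) :
  (forall y, F y -> f y = g (S y)) -> is_derive (S x) 1 g l ->
  Fderivable F alpha a0 f x.
Proof. by move=> fg gl Fx; apply: cvgP (Fquotient_cvg Fx fg gl). Qed.

Lemma Fderive_comp (f g : R -> R) (l x : R) : F x ->
  (forall y, F y -> f y = g (S y)) -> is_derive (S x) 1 g l ->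
  Fderive F alpha a0 f x = l.
Proof.
move=> Fx fg gl; rewrite /Fderive mem_set//.
have [_ _ isoF _] := perfectF; have := within_dnbhs_proper isoF Fx => FF.
apply: cvg_lim; first exact: Rhausdorff.
exact: Fquotient_cvg gl.
Qed.

(** The classical equation as a first-order system: the derivative is carried explicitly as [g1]. *)
Definition ode_solution (a1 a2 : R) (g g1 : R -> R) :=
  forall s : R, is_derive s 1 g (g1 s) /\
            is_derive s 1 g1 (- a1 * g1 s - a2 * g s).

Lemma is_solution_comp (a b a1 a2 : R) (f g g1 : R -> R) :
  (forall x, f x = g (S x)) -> ode_solution a1 a2 g g1 ->
  is_solution F alpha a0 a b a1 a2 f.
Proof.
move=> fg gode; have Ff y : F y -> Fderive F alpha a0 f y = g1 (S y).
  by move=> Fy; apply: (Fderive_comp Fy (fun z _ => fg z)); exact: (gode _).1.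
(* The orders 0 and 1 are the only ones below 2; at order 1 the F-derivative is known as [g1 \o S]
   on [F] only. *)
split=> [[|[|//]] x _ _ _|x _ /set_mem Fx] /=.
- by apply: Fderivable_comp (fun z _ => fg z) _; exact: (gode _).1.
- by apply: Fderivable_comp Ff _; exact: (gode _).2.
- rewrite (Fderive_comp Fx Ff (gode _).2) Ff// fg; ring.
Qed.

End alpha_perfect_derivative.

(** * Classical second-order equations with constant coefficients *)

Section constant_coefficients.
Context {R : realType}.
Implicit Types (g p q : R -> R).

Lemma ode_solution_lin (a1 a2 c d : R) p p1 q q1 :
  ode_solution a1 a2 p p1 -> ode_solution a1 a2 q q1 ->
  ode_solution a1 a2 (fun s => c * p s + d * q s)
    (fun s => c * p1 s + d * q1 s).
Proof.
move=> po qo s; have [dp dp1] := po s; have [dq dq1] := qo s.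
split; apply: is_derive_eq; rewrite /GRing.scale/=; ring.
Qed.

Lemma is_derive_scale g (r s l : R) : is_derive (r * s) 1 g l ->
  is_derive s 1 (fun t => g (r * t)) (r * l).
Proof.
move=> gl; have dr : is_derive s 1 (fun t : R => r * t) r.
  by apply: is_derive_eq; rewrite /GRing.scale/= mulr1.
by rewrite mulrC; exact: is_derive1_comp gl dr.
Qed.

Lemma rootE (a1 a2 r : R) : root (characteristic a1 a2) r ->
  r ^+ 2 = - a1 * r - a2.
Proof.
by rewrite /root /characteristic !hornerE => /eqP; lra.
Qed.

Lemma complex_rootE (a1 a2 lambda nu : R) : nu != 0 ->
  root (map_poly (real_complex R) (characteristic a1 a2)) (Complex lambda nu) ->
  a1 = - 2 * lambda /\ a2 = lambda ^+ 2 + nu ^+ 2.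
Proof.
move=> nu0; rewrite /root /characteristic !rmorphD/= map_polyZ map_polyXn.
rewrite map_polyX map_polyC/= !hornerE => /eqP; rewrite expr2 => -[].
rewrite !(mulr0, mul0r, subr0, addr0, add0r) => re im.
(* The imaginary part of the characteristic equation is [nu * (2 * lambda + a1) = 0]; the real part
   then gives [a2]. *)
have a1E : a1 = - 2 * lambda.
  by apply: (mulIf nu0); lra.
by split=> //; move: re; rewrite a1E; lra.
Qed.

Lemma ode_solution_expR (a1 a2 r : R) : r ^+ 2 = - a1 * r - a2 ->
  ode_solution a1 a2 (fun s => expR (r * s)) (fun s => r * expR (r * s)).
Proof.
move=> r2 s; have de := is_derive_scale (is_derive_expR (r * s)).
split=> //; apply: is_derive_eq.
by rewrite /GRing.scale/= mulrA -expr2 r2; ring.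
Qed.

Lemma ode_solution_expR_cos (lambda nu : R) :
  ode_solution (- 2 * lambda) (lambda ^+ 2 + nu ^+ 2)
    (fun s => expR (lambda * s) * cos (nu * s))
    (fun s => expR (lambda * s) *
              (lambda * cos (nu * s) - nu * sin (nu * s))).
Proof.
move=> s.
have de := is_derive_scale (is_derive_expR (lambda * s)).
have dc := is_derive_scale (is_derive_cos (nu * s)).
have ds := is_derive_scale (is_derive_sin (nu * s)).
split; apply: is_derive_eq; rewrite /GRing.scale/=; ring.
Qed.

Lemma ode_solution_expR_sin (lambda nu : R) :
  ode_solution (- 2 * lambda) (lambda ^+ 2 + nu ^+ 2)
    (fun s => expR (lambda * s) * sin (nu * s))
    (fun s => expR (lambda * s) *
              (lambda * sin (nu * s) + nu * cos (nu * s))).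
Proof.
move=> s.
have de := is_derive_scale (is_derive_expR (lambda * s)).
have dc := is_derive_scale (is_derive_cos (nu * s)).
have ds := is_derive_scale (is_derive_sin (nu * s)).
split; apply: is_derive_eq; rewrite /GRing.scale/=; ring.
Qed.

Lemma ode_solution_id_expR (r : R) :
  ode_solution (- 2 * r) (r ^+ 2) (fun s => s * expR (r * s))
    (fun s => (1 + r * s) * expR (r * s)).
Proof.
move=> s; have de := is_derive_scale (is_derive_expR (r * s)).
split; apply: is_derive_eq; rewrite /GRing.scale/=; ring.
Qed.

(** The last clause is the nonvanishing of the Wronskian. It equals [(r2 - r1)] times a product of
    exponentials, [nu] times a squared exponential, or a squared exponential, in the three cases
    respectively. *)
Lemma fundamental_pair_ode (S : R -> R) (a1 a2 : R) (psi1 psi2 : R -> R) :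
  fundamental_pair S a1 a2 psi1 psi2 ->
  exists p p1 q q1, [/\ psi1 = p \o S, psi2 = q \o S,
    ode_solution a1 a2 p p1, ode_solution a1 a2 q q1 &
    forall s, p s * q1 s - q s * p1 s != 0].
Proof.
case=> [r1 r2 _ r12 /rootE root1 /rootE root2|lambda nu _ nu0|disc].
- exists (fun s => expR (r1 * s)), (fun s => r1 * expR (r1 * s)).
  exists (fun s => expR (r2 * s)), (fun s => r2 * expR (r2 * s)).
  split=> //; [exact: ode_solution_expR|exact: ode_solution_expR|move=> s].
  have -> : expR (r1 * s) * (r2 * expR (r2 * s)) -
      expR (r2 * s) * (r1 * expR (r1 * s)) =
      (r2 - r1) * (expR (r1 * s) * expR (r2 * s)) by ring.
  apply: mulf_neq0; first by rewrite subr_eq0 eq_sym.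
  by rewrite mulf_neq0// gt_eqF// expR_gt0.
- move=> /(complex_rootE nu0)[-> ->] _.
  exists (fun s => expR (lambda * s) * cos (nu * s)).
  exists (fun s => expR (lambda * s) *
                   (lambda * cos (nu * s) - nu * sin (nu * s))).
  exists (fun s => expR (lambda * s) * sin (nu * s)).
  exists (fun s => expR (lambda * s) *
                   (lambda * sin (nu * s) + nu * cos (nu * s))).
  split=> //.
  + exact: ode_solution_expR_cos.
  + exact: ode_solution_expR_sin.
  move=> s.
  have cs := cos2Dsin2 (nu * s).
  set e := expR _; set c := cos _ in cs *; set t := sin _ in cs *.
  have -> : e * c * (e * (lambda * t + nu * c)) -
      e * t * (e * (lambda * c - nu * t)) =
      e ^+ 2 * nu * (c ^+ 2 + t ^+ 2) by ring.
  by rewrite cs mulr1 mulf_neq0// expf_neq0// gt_eqF// expR_gt0.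
(* [r] is the double root; both coefficients are rewritten through it, the second by the zero
   discriminant. *)
- pose r := - a1 / 2.
  have -> : a1 = - 2 * r by rewrite /r; field.
  have -> : a2 = r ^+ 2 by rewrite /r; lra.
  have expE x : expR (- (- 2 * r) * S x / 2) = expR (r * S x).
    by congr expR; field.
  exists (fun s => expR (r * s)), (fun s => r * expR (r * s)).
  exists (fun s => s * expR (r * s)), (fun s => (1 + r * s) * expR (r * s)).
  split; [by apply/funext => x; exact: expE|
    by apply/funext => x; rewrite expE| | |move=> s].
  + by apply: ode_solution_expR; ring.
  + exact: ode_solution_id_expR.
  + have -> : expR (r * s) * ((1 + r * s) * expR (r * s)) -
      s * expR (r * s) * (r * expR (r * s)) = expR (r * s) ^+ 2 by ring.
    by rewrite expf_neq0// gt_eqF// expR_gt0.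
Qed.

End constant_coefficients.

(** * The initial value problem *)

Theorem theorem2 (R : realType) (alpha a0 a b : R) (F : set R)
  (halpha : 0 < alpha <= 1) (hF : alpha_perfect F alpha a0)
  (a1 a2 x0 f0 f0' : R) (hx0 : x0 \in `]a, b[) (hx0F : x0 \in F)
  (psi1 psi2 : R -> R)
  (hpsi : fundamental_pair (staircase F alpha a0) a1 a2 psi1 psi2) :
  exists c1 c2 : R,
    let psi := fun x => c1 * psi1 x + c2 * psi2 x in
    [/\ is_solution F alpha a0 a b a1 a2 psi,
        psi x0 = f0 &
        Fderive F alpha a0 psi x0 = f0'].
Proof.
have alpha_gt0 : 0 < alpha by case/andP: halpha.
have Fx0 := set_mem hx0F.
have [p [p1 [q [q1 [-> -> podE qode wronskian]]]]] := fundamental_pair_ode hpsi.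
have := wronskian (staircase F alpha a0 x0).
move sE : (staircase F alpha a0 x0) => s W0.
pose W := p s * q1 s - q s * p1 s.
(* Cramer's rule for [c * p s + d * q s = f0] and [c * p1 s + d * q1 s = f0']. *)
pose c := (f0 * q1 s - f0' * q s) / W; pose d := (f0' * p s - f0 * p1 s) / W.
have cdode := ode_solution_lin c d podE qode.
exists c, d => psi.
have psiE y :
  psi y = (fun t => c * p t + d * q t) (staircase F alpha a0 y) by [].
split.
- exact: is_solution_comp psiE cdode.
- by rewrite psiE sE /c /d /W; field.
- rewrite (Fderive_comp alpha_gt0 hF Fx0 (fun y _ => psiE y) (cdode _).1).
  by rewrite sE /c /d /W; field.
Qed.
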